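(* For an algebra $\mathcal{B}$ in a functional language $\mathtt{L}$ the following conditions are equivalent: 1) $\mathcal{B}$ is $\mathrm{q}_\omega$-compact; 2) for any finite set $X$, any system of equations $S\subseteq\mathrm{At}_{\mathtt{L}}(X)$, and any consequence $c=(t_0=s_0)\in\mathrm{Rad}_{\mathcal{B}}(S)$ there exists a finite subsystem $S_c\subseteq S$ such that $c\in\mathrm{Rad}_{\mathcal{B}}(S_c)$; 3) for any finite set $X=\{x_1,\dots,x_n\}$, any subset $S\subseteq\mathrm{At}_{\mathtt{L}}(X)$, and any atomic formula $(t_0=s_0)\in\mathrm{At}_{\mathtt{L}}(X)$, if the (infinite) formula $$\forall x_1\ldots\forall x_n\Big(\bigwedge_{(t=s)\in S}t(\bar x)=s(\bar x)\;\longrightarrow\;t_0(\bar x)=s_0(\bar x)\Big)$$ holds in $\mathcal{B}$, then for some finite subsystem $S_c\subseteq S$ the quasi-identity $$\forall x_1\ldots\forall x_n\Big(\bigwedge_{(t=s)\in S_c}t(\bar x)=s(\bar x)\;\longrightarrow\;t_0(\bar x)=s_0(\bar x)\Big)$$ also holds in $\mathcal{B}$; 4) for any finite set $X$, any subset $S\subseteq\mathrm{At}_{\mathtt{L}}(X)$, and any atomic formula $(t_0=s_0)\in\mathrm{At}_{\mathtt{L}}(X)$, if the set of formulas $T=S\cup\{\neg(t_0=s_0)\}$ is finitely satisfiable in $\mathcal{B}$, then it is satisfiable in $\mathcal{B}$; 5) every finitely generated algebra from $\mathbf{Qvar}(\mathcal{B})$ is the coordinate algebra of an algebraic set over $\mathcal{B}$;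 6) $\mathbf{Qvar}(\mathcal{B})_\omega=\mathbf{Pvar}(\mathcal{B})_\omega$; 7) $\mathbf{Qvar}(\mathcal{B})=\mathbf{L_{fg}}\mathbf{Res}(\mathcal{B})$; 8) $\underrightarrow{\mathbf{L}}_{s}\mathbf{S}\mathbf{P}(\mathcal{B})=\mathbf{L_{fg}}\mathbf{S}\mathbf{P}(\mathcal{B})$; 9) $\underrightarrow{\mathbf{L}}\,\mathbf{S}\mathbf{P}(\mathcal{B})=\mathbf{L_{fg}}\mathbf{S}\mathbf{P}(\mathcal{B})$; 10) for any finite set $X$ and any system of equations $S\subseteq\mathrm{At}_{\mathtt{L}}(X)$ one has $\mathrm{Rad}_{\mathcal{B}}(S)=\bigcup_{S_0\subseteq S}\mathrm{Rad}_{\mathcal{B}}(S_0)$, where $S_0$ runs over all finite subsystems of $S$; 11) for any finite set $X$ and any directed system $\{S_i, i\in I\}$ of radical ideals over $\mathcal{B}$ from $\mathrm{At}_{\mathtt{L}}(X)$ the union $S=\bigcup_{i\in I}S_i$ is a radical ideal over $\mathcal{B}$; 12) for any finite set $X$ and any epimorphic direct system $\Lambda=(I,\mathcal{C}_i,h_{ij})$ of coordinate algebras over $\mathcal{B}$ with generating set $X$ and $h_{ij}(x)=x$ for $x\in X$, the epimorphic direct limit $\underrightarrow{\lim}\,\mathcal{C}_i$ is a coordinate algebra over $\mathcal{B}$.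
   Context: A functional language $\mathtt{L}$ is a first-order language with function and constant symbols only (and equality); $\mathtt{L}$-structures are called $\mathtt{L}$-algebras. For a finite set of variables $X=\{x_1,\dots,x_n\}$, $\mathcal{T}_{\mathtt{L}}(X)$ is the absolutely free algebra of terms, and $\mathrm{At}_{\mathtt{L}}(X)$ is the set of atomic formulas $(t=s)$ in variables $X$ (equations). A system of equations is a subset $S\subseteq \mathrm{At}_{\mathtt{L}}(X)$; $\mathrm{V}_{\mathcal{B}}(S)\subseteq B^n$ is its solution set in $\mathcal{B}$ (possibly empty); sets of this form are the algebraic sets over $\mathcal{B}$. The radical $\mathrm{Rad}_{\mathcal{B}}(S)$ (also written $\mathrm{Rad}(Y)$ for $Y=\mathrm{V}_{\mathcal{B}}(S)$) is the largest system of equations in $\mathrm{At}_{\mathtt{L}}(X)$ with the same solution set as $S$, i.e. the set of all $(t=s)\in\mathrm{At}_{\mathtt{L}}(X)$ with $\mathrm{V}_{\mathcal{B}}(S)\subseteq\mathrm{V}_{\mathcal{B}}(t=s)$. A system $S\subseteq\mathrm{At}_{\mathtt{L}}(X)$ is a radical ideal over $\mathcal{B}$ if $S=\mathrm{Rad}_{\mathcal{B}}(S)$; it defines the congruence $\theta_S$ on $\mathcal{T}_{\mathtt{L}}(X)$, $t_1\sim t_2$ iff $(t_1=t_2)\in S$. The coordinate algebra of $Y$ is $\Gamma(Y)=\mathcal{T}_{\mathtt{L}}(X)/\theta_{\mathrm{Rad}(Y)}$; a coordinate algebra over $\mathcal{B}$ is an algebra isomorphic to $\Gamma(Y)$ for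 some algebraic set $Y$ over $\mathcal{B}$. $\mathcal{B}$ is $\mathrm{q}_\omega$-compact if for any finite $X$, any $S\subseteq\mathrm{At}_{\mathtt{L}}(X)$ and any equation $(t_0=s_0)\in\mathrm{At}_{\mathtt{L}}(X)$ with $\mathrm{V}_{\mathcal{B}}(S)\subseteq\mathrm{V}_{\mathcal{B}}(t_0=s_0)$ there is a finite $S_0\subseteq S$ with $\mathrm{V}_{\mathcal{B}}(S_0)\subseteq\mathrm{V}_{\mathcal{B}}(t_0=s_0)$. A set of formulas is satisfiable in $\mathcal{B}$ if elements of $\mathcal{B}$ can be assigned to its variables making all its formulas true; finitely satisfiable if each finite subset is satisfiable in $\mathcal{B}$. Directed systems: a partial order is directed if any two elements have an upper bound. A family $\{S_i,i\in I\}$ of radical ideals is a directed system if $I$ is a directed partial order with $i\le j\Leftrightarrow\theta_{S_i}\subseteq\theta_{S_j}$. A direct system $(I,\mathcal{C}_i,h_{ij})$ of algebras (over a directed partial order, with homomorphisms $h_{ij}\colon\mathcal{C}_i\to\mathcal{C}_j$, $i\le j$, satisfying the usual compatibility) is epimorphic if all $h_{ij}$ are surjective; its direct limit is then called an epimorphic direct limit. Operators on classes $\mathbf{K}$ of $\mathtt{L}$-algebras (all up to isomorphism; $\mathbf{K}=\{\mathcal{B}\}$ is written $\mathcal{B}$): $\mathbf{S}(\mathbf{K})$ subalgebras of algebras from $\mathbf{K}$; $\mathbf{P}(\mathbf{K})$ direct products (the empty product being the trivial one-element algebra); $\underrightarrow{\mathbf{L}}(\mathbf{K})$ direct limits; $\underrightarrow{\mathbf{L}}_{s}(\mathbf{K})$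 epimorphic direct limits; $\mathbf{L_{fg}}(\mathbf{K})$ algebras all of whose finitely generated subalgebras belong to $\mathbf{K}$; $\mathbf{K}_\omega$ finitely generated algebras from $\mathbf{K}$; $\mathbf{Qvar}(\mathbf{K})$ the least quasivariety containing $\mathbf{K}$, i.e. the class of models of all quasi-identities true in $\mathbf{K}$; $\mathbf{Pvar}(\mathbf{K})$ the least prevariety (class closed under subalgebras and direct products) containing $\mathbf{K}$; $\mathbf{Res}(\mathcal{B})$ the class of algebras separated by $\mathcal{B}$, where $\mathcal{C}$ is separated by $\mathcal{B}$ if for any $c_1\ne c_2$ in $C$ there is a homomorphism $h\colon\mathcal{C}\to\mathcal{B}$ with $h(c_1)\neq h(c_2)$ (the trivial algebra is separated by every $\mathcal{B}$). *)

(* Defs.v *)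
From HB Require Import structures.
From mathcomp Require Import all_boot all_order.
From mathcomp Require Import mathcomp_extra boolp classical_sets functions.
From mathcomp Require Import cardinality.

Set Implicit Arguments.
Unset Strict Implicit.
Unset Printing Implicit Defensive.

Local Open Scope classical_set_scope.
Local Open Scope quotient_scope.

(* Constant symbols are the symbols of arity 0. *)
Record language := Language { symbol :> Type; arity : symbol -> nat }.

Record algebra (L : language) := Algebra {
  carrier :> Type;
  op : forall f : L, ('I_(arity f) -> carrier) -> carrier;
  algebra_inhabited : inhabited carrier }.
Arguments op {L} a f _.

(* Classes are predicates and not elements of [set (algebra L)]: the universe of
   [set] is bounded by that of choiceType, hence, through quotients, by that
   of the carriers, so the latter type would be a universe inconsistency. *)
Definition algebra_class (L : language) := algebra L -> Prop.

Definition class_incl (L : language) (K1 K2 : algebra_class L) : Prop :=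
  forall C, K1 C -> K2 C.

Definition class_eq (L : language) (K1 K2 : algebra_class L) : Prop :=
  forall C, K1 C <-> K2 C.

Section Morphisms.
Variable L : language.

Definition hom (A B : algebra L) (h : A -> B) : Prop :=
  forall (f : L) (a : 'I_(arity f) -> A), h (op A f a) = op B f (h \o a).

Definition surj (A B : algebra L) (h : A -> B) : Prop :=
  forall b, exists a, h a = b.

Definition isomorphic (A B : algebra L) : Prop :=
  exists2 h : A -> B, hom h & bijective h.

End Morphisms.

Section Subalgebras.
Variables (L : language) (A : algebra L).

Definition op_closed (D : set A) : Prop :=
  forall (f : L) (a : 'I_(arity f) -> A), (forall i, D (a i)) -> D (op A f a).

Record subalgebra := Subalgebra {
  sub_set : set A;
  sub_closed : op_closed sub_set;
  sub_nonempty : sub_set !=set0 }.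

Variable D : subalgebra.

Definition sub_op (f : L) (a : 'I_(arity f) -> sub_set D) : sub_set D :=
  exist _ (op A f (fun i => val (a i)))
    (mem_set (sub_closed (fun i => set_mem (valP (a i))))).

Lemma sub_inhabited : inhabited (sub_set D).
Proof. by have [x Dx] := sub_nonempty D; exact: (inhabits (exist _ x (mem_set Dx))). Qed.

Definition sub_algebra : algebra L := Algebra sub_op sub_inhabited.

End Subalgebras.

Definition generated (L : language) (A : algebra L) (G : set A) : set A :=
  \bigcap_(D in [set D | op_closed D /\ G `<=` D]) D.

Definition finitely_generated (L : language) (A : algebra L) : Prop :=
  exists2 G : set A, finite_set G & generated G = setT.

Section Products.
Variables (L : language) (I : Type) (A : I -> algebra L).

Definition prod_op (f : L) (a : 'I_(arity f) -> forall i, A i) : forall i, A i :=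
  fun i => op (A i) f (fun k => a k i).

Lemma prod_inhabited : inhabited (forall i, A i).
Proof.
have inh i : exists x : A i, True by case: (algebra_inhabited (A i)) => x; exists x.
exact: (inhabits (fun i => projT1 (cid (inh i)))).
Qed.

Definition prod_algebra : algebra L := Algebra prod_op prod_inhabited.

End Products.

Record congruence (L : language) (A : algebra L) := Congruence {
  crel :> A -> A -> Prop;
  crel_refl : forall x, crel x x;
  crel_sym : forall x y, crel x y -> crel y x;
  crel_trans : forall x y z, crel x y -> crel y z -> crel x z;
  crel_op : forall (f : L) (a b : 'I_(arity f) -> A),
    (forall i, crel (a i) (b i)) -> crel (op A f a) (op A f b) }.

Section PropQuotient.
Variables (T : Type) (R : T -> T -> Prop).
Hypotheses (Rrefl : forall x, R x x) (Rsym : forall x y, R x y -> R y x)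
  (Rtrans : forall x y z, R x y -> R y z -> R x z).

Definition brel : rel {classic T} := fun x y => `[< R x y >].

Lemma brel_refl : reflexive brel. Proof. by move=> x; exact/asboolP. Qed.

Lemma brel_sym : symmetric brel.
Proof. by move=> x y; apply/asboolP/asboolP; exact: Rsym. Qed.

Lemma brel_trans : transitive brel.
Proof. by move=> y x z /asboolP xy /asboolP yz; apply/asboolP/Rtrans/yz. Qed.

Definition prop_equiv : equiv_rel {classic T} :=
  EquivRel brel brel_refl brel_sym brel_trans.

Lemma prop_equivP (x y : T) :
  (\pi_{eq_quot prop_equiv} x = \pi_{eq_quot prop_equiv} y) <-> R x y.
Proof. by split=> [/eqmodP/asboolP//|xy]; apply/eqmodP/asboolP. Qed.

End PropQuotient.

Section Quotient.
Variables (L : language) (A : algebra L) (theta : congruence A).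

Definition quot_equiv : equiv_rel {classic A} :=
  prop_equiv (@crel_refl _ _ theta) (@crel_sym _ _ theta) (@crel_trans _ _ theta).

Definition quot_carrier : Type := {eq_quot quot_equiv}.

Definition quot_class (x : A) : quot_carrier := \pi_{eq_quot quot_equiv} x.

(* Computed on chosen representatives; independent of the choice by
   [quot_class_hom]. *)
Definition quot_op (f : L) (a : 'I_(arity f) -> quot_carrier) : quot_carrier :=
  quot_class (op A f (fun i => repr (a i : {eq_quot quot_equiv}) : A)).

Lemma quot_inhabited : inhabited quot_carrier.
Proof. by case: (algebra_inhabited A) => x; exact: (inhabits (quot_class x)). Qed.

Definition quot_algebra : algebra L := Algebra quot_op quot_inhabited.

Lemma quot_classP (x y : A) : quot_class x = quot_class y <-> theta x y.
Proof. exact: prop_equivP. Qed.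

Lemma quot_class_hom : hom (quot_class : A -> quot_algebra).
Proof.
move=> f a; apply/quot_classP/crel_op => i; apply/quot_classP.
by rewrite /= /quot_class reprK.
Qed.

End Quotient.

Inductive term (L : language) (X : Type) : Type :=
| Var of X
| App (f : L) of 'I_(arity f) -> term L X.
Arguments Var {L X} _.
Arguments App {L X} f _.

(* Algebras being nonempty, T_L(X) is an algebra unless X is empty and L has no
   constants; [T0] excludes exactly that case. *)
Definition term_algebra (L : language) (X : Type) (T0 : inhabited (term L X)) :
  algebra L := Algebra (@App L X) T0.

Fixpoint eval (L : language) (X : Type) (B : algebra L) (v : X -> B)
    (t : term L X) : B :=
  match t with
  | Var x => v x
  | App f a => op B f (fun i => eval v (a i))
  end.

(* At_L(X) for X = {x_1, ..., x_n} *)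
Definition equation (L : language) (n : nat) : Type :=
  (term L 'I_n * term L 'I_n)%type.

Definition satisfies (L : language) (n : nat) (B : algebra L)
  (v : 'I_n -> B) (e : equation L n) : Prop := eval v e.1 = eval v e.2.

Section Radicals.
Variables (L : language) (B : algebra L) (n : nat).

Definition solutions (S : set (equation L n)) : set ('I_n -> B) :=
  [set v | forall e, S e -> satisfies v e].

Definition algebraic_set (Y : set ('I_n -> B)) : Prop :=
  exists S : set (equation L n), Y = solutions S.

Definition rad_of (Y : set ('I_n -> B)) : set (equation L n) :=
  [set e | Y `<=` solutions [set e]].

Definition radical (S : set (equation L n)) : set (equation L n) :=
  rad_of (solutions S).

Definition radical_ideal (S : set (equation L n)) : Prop := S = radical S.

Definition theta (S : set (equation L n)) : term L 'I_n -> term L 'I_n -> Prop :=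
  fun t1 t2 => S (t1, t2).

Lemma rad_ofP (Y : set ('I_n -> B)) (t s : term L 'I_n) :
  theta (rad_of Y) t s <-> forall v, Y v -> eval v t = eval v s.
Proof.
split=> [h v Yv|h v Yv _ ->]; last exact: h.
exact: (h v Yv (t, s) erefl).
Qed.

Section Coordinate.
Variables (T0 : inhabited (term L 'I_n)) (Y : set ('I_n -> B)).
Let T := term_algebra T0.

Lemma theta_refl (t : T) : theta (rad_of Y) t t.
Proof. exact/rad_ofP. Qed.

Lemma theta_sym (t s : T) : theta (rad_of Y) t s -> theta (rad_of Y) s t.
Proof. by move=> /rad_ofP ts; apply/rad_ofP => v /ts. Qed.

Lemma theta_trans (t s u : T) :
  theta (rad_of Y) t s -> theta (rad_of Y) s u -> theta (rad_of Y) t u.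
Proof.
by move=> /rad_ofP ts /rad_ofP su; apply/rad_ofP => v Yv; rewrite ts ?su.
Qed.

Lemma theta_op (f : L) (a b : 'I_(arity f) -> T) :
  (forall i, theta (rad_of Y) (a i) (b i)) ->
  theta (rad_of Y) (op T f a) (op T f b).
Proof.
move=> ab; apply/rad_ofP => v Yv /=; congr (op B f).
by apply: funext => i; move/rad_ofP: (ab i); apply.
Qed.

Definition theta_congruence : congruence T :=
  Congruence theta_refl theta_sym theta_trans theta_op.

Definition Gamma : algebra L := quot_algebra theta_congruence.

End Coordinate.
End Radicals.

Definition coordinate_algebra (L : language) (B C : algebra L) : Prop :=
  exists (n : nat) (T0 : inhabited (term L 'I_n)) (Y : set ('I_n -> B)),
    algebraic_set Y /\ isomorphic C (Gamma T0 Y).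

Definition q_omega_compact (L : language) (B : algebra L) : Prop :=
  forall (n : nat) (S : set (equation L n)) (c : equation L n),
    solutions (B := B) S `<=` solutions [set c] ->
    exists S0 : set (equation L n),
      [/\ finite_set S0, S0 `<=` S & solutions (B := B) S0 `<=` solutions [set c]].

(* The universally quantified, possibly infinitary, implication
   forall x_1 ... x_n, /\ premises -> conclusion *)
Record implication (L : language) (n : nat) := Implication {
  premises : set (equation L n);
  conclusion : equation L n }.

Definition quasi_identity (L : language) (n : nat) (phi : implication L n) : Prop :=
  finite_set (premises phi).

Definition holds (L : language) (n : nat) (B : algebra L)
    (phi : implication L n) : Prop :=
  forall v : 'I_n -> B,
    (forall e, premises phi e -> satisfies v e) -> satisfies v (conclusion phi).

Inductive literal (L : language) (n : nat) : Type :=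
| Pos of equation L n
| Neg of equation L n.

Definition literal_true (L : language) (n : nat) (B : algebra L)
    (v : 'I_n -> B) (l : literal L n) : Prop :=
  match l with
  | Pos e => satisfies v e
  | Neg e => ~ satisfies v e
  end.

Definition satisfiable (L : language) (n : nat) (B : algebra L)
    (T : set (literal L n)) : Prop :=
  exists v : 'I_n -> B, forall l, T l -> literal_true v l.

Definition finitely_satisfiable (L : language) (n : nat) (B : algebra L)
    (T : set (literal L n)) : Prop :=
  forall T0 : set (literal L n), finite_set T0 -> T0 `<=` T -> satisfiable B T0.

Definition directed (d : Order.disp_t) (I : porderType d) : Prop :=
  inhabited I /\ forall i j : I, exists k : I, (i <= k)%O /\ (j <= k)%O.

Record direct_system (L : language) (d : Order.disp_t) (I : porderType d) :=
  DirectSystem {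
    obj : I -> algebra L;
    tr : forall i j : I, (i <= j)%O -> obj i -> obj j;
    tr_hom : forall (i j : I) (ij : (i <= j)%O), hom (tr ij);
    tr_id : forall (i : I) (ii : (i <= i)%O) (x : obj i), tr ii x = x;
    tr_comp : forall (i j k : I) (ij : (i <= j)%O) (jk : (j <= k)%O)
      (ik : (i <= k)%O) (x : obj i), tr jk (tr ij x) = tr ik x }.
Arguments tr {L d I} Lam {i j} _ _ : rename.

Definition epimorphic (L : language) (d : Order.disp_t) (I : porderType d)
    (Lam : direct_system L I) : Prop :=
  forall (i j : I) (ij : (i <= j)%O), surj (tr Lam ij).

Section DirectLimit.
Variables (L : language) (d : Order.disp_t) (I : porderType d).
Variables (Lam : direct_system L I) (dirI : directed I).

Let U : Type := {i : I & obj Lam i}.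

(* The limit is the quotient of the disjoint union of the algebras that
   identifies two elements having the same image at some later stage. *)
Definition lim_rel (x y : U) : Prop :=
  exists (k : I) (xk : (projT1 x <= k)%O) (yk : (projT1 y <= k)%O),
    tr Lam xk (projT2 x) = tr Lam yk (projT2 y).

Lemma lim_refl (x : U) : lim_rel x x.
Proof. by exists (projT1 x), (Order.POrderTheory.lexx _), (Order.POrderTheory.lexx _). Qed.

Lemma lim_sym (x y : U) : lim_rel x y -> lim_rel y x.
Proof. by move=> [k [xk [yk e]]]; exists k, yk, xk. Qed.

Lemma lim_trans (x y z : U) : lim_rel x y -> lim_rel y z -> lim_rel x z.
Proof.
move=> [k [xk [yk e]]] [l [yl [zl e']]].
have [m [km lm]] := dirI.2 k l.
have le_m := Order.POrderTheory.le_trans.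
exists m, (le_m _ _ _ _ _ xk km), (le_m _ _ _ _ _ zl lm).
rewrite -(tr_comp xk km) e (tr_comp yk km (le_m _ _ _ _ _ yl lm)).
by rewrite -(tr_comp yl lm) e' (tr_comp zl lm (le_m _ _ _ _ _ zl lm)).
Qed.

Definition lim_equiv : equiv_rel {classic U} :=
  prop_equiv lim_refl lim_sym lim_trans.

Definition lim_carrier : Type := {eq_quot lim_equiv}.

Definition lim_inj (i : I) (x : obj Lam i) : lim_carrier :=
  \pi_{eq_quot lim_equiv} (existT (obj Lam) i x : U).

Lemma upper_bound (k : nat) (s : 'I_k -> I) : {j : I | forall x, (s x <= j)%O}.
Proof.
apply: cid; elim: k s => [|k IH] s.
  by case: dirI.1 => i; exists i => -[].
have [j sj] := IH (fun x => s (lift ord0 x)).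
have [m [jm sm]] := dirI.2 j (s ord0).
exists m => x; case: (unliftP ord0 x) => [y ->|-> //].
exact: Order.POrderTheory.le_trans jm.
Qed.

(* Transport chosen representatives of the arguments to a common stage and apply
   the operation there; independent of the choices by [lim_inj_hom]. *)
Definition lim_op (f : L) (a : 'I_(arity f) -> lim_carrier) : lim_carrier :=
  let r x : U := repr (a x : {eq_quot lim_equiv}) in
  let (j, rj) := upper_bound (fun x => projT1 (r x)) in
  lim_inj (op (obj Lam j) f (fun x => tr Lam (rj x) (projT2 (r x)))).

Lemma lim_inhabited : inhabited lim_carrier.
Proof.
case: dirI.1 => i; case: (algebra_inhabited (obj Lam i)) => x.
exact: (inhabits (lim_inj x)).
Qed.

Definition direct_limit : algebra L := Algebra lim_op lim_inhabited.

Lemma lim_injP (i j : I) (x : obj Lam i) (y : obj Lam j) :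
  lim_inj x = lim_inj y <->
  exists (k : I) (ik : (i <= k)%O) (jk : (j <= k)%O), tr Lam ik x = tr Lam jk y.
Proof. exact: prop_equivP. Qed.

Lemma lim_inj_hom (i : I) : hom (@lim_inj i : obj Lam i -> direct_limit).
Proof.
move=> f a /=; rewrite /lim_op.
pose r (x : 'I_(arity f)) : U := repr (lim_inj (a x) : {eq_quot lim_equiv}).
case: upper_bound => j rj; change (forall x, (projT1 (r x) <= j)%O) in rj.
have le_m := Order.POrderTheory.le_trans.
have E x : lim_rel (r x) (existT (obj Lam) i (a x)).
  apply/(prop_equivP lim_refl lim_sym lim_trans); exact: reprK.
have [k0 [jk0 ik0]] := dirI.2 j i.
have [k1 k1P] := upper_bound (fun x => projT1 (cid (E x))).
have [k [k0k k1k]] := dirI.2 k0 k1.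
have jk := le_m _ _ _ _ _ jk0 k0k; have ik := le_m _ _ _ _ _ ik0 k0k.
apply/lim_injP; exists k, ik, jk; rewrite !tr_hom; congr (op _ f).
apply: funext => x /=; move: (k1P x).
case: (cid (E x)) => m /= [xm [im e]] mk1.
have mk := le_m _ _ _ _ _ mk1 k1k.
rewrite -/(r x) (tr_comp _ _ (le_m _ _ _ _ _ xm mk)) -(tr_comp xm mk) e.
by rewrite (tr_comp im mk ik).
Qed.

End DirectLimit.

Section Operators.
Variable L : language.
Implicit Types K : algebra_class L.

Definition class_of (B : algebra L) : algebra_class L := fun C => isomorphic C B.

Definition opS K : algebra_class L := fun C =>
  exists2 A, K A & exists D : subalgebra A, isomorphic C (sub_algebra D).

Definition opP K : algebra_class L := fun C =>
  exists (I : Type) (A : I -> algebra L),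
    (forall i, K (A i)) /\ isomorphic C (prod_algebra A).

Definition opL K : algebra_class L := fun C =>
  exists (d : Order.disp_t) (I : porderType d) (Lam : direct_system L I)
    (dirI : directed I),
    (forall i, K (obj Lam i)) /\ isomorphic C (direct_limit Lam dirI).

Definition opLs K : algebra_class L := fun C =>
  exists (d : Order.disp_t) (I : porderType d) (Lam : direct_system L I)
    (dirI : directed I),
    [/\ forall i, K (obj Lam i), epimorphic Lam &
        isomorphic C (direct_limit Lam dirI)].

Definition opLfg K : algebra_class L := fun C =>
  forall D : subalgebra C,
    finitely_generated (sub_algebra D) -> K (sub_algebra D).

Definition op_omega K : algebra_class L := fun C => K C /\ finitely_generated C.

Definition Qvar K : algebra_class L := fun C =>
  forall (n : nat) (phi : implication L n), quasi_identity phi ->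
    (forall A, K A -> holds A phi) -> holds C phi.

Definition prevariety K : Prop := class_incl (opS K) K /\ class_incl (opP K) K.

Definition Pvar K : algebra_class L := fun C =>
  forall K', prevariety K' -> class_incl K K' -> K' C.

Definition Res (B : algebra L) : algebra_class L := fun C =>
  forall c1 c2 : C, c1 <> c2 -> exists2 h : C -> B, hom h & h c1 <> h c2.

End Operators.

(* Main.v *)
(** An algebra is separated by B exactly when it lies in SP(B) = Pvar(B), and the
    coordinate algebras over B are exactly the finitely generated separated
    algebras. So conditions 5-7 all say that every finitely generated algebra of
    Qvar(B) is separated by B. Applied to the term algebra modulo the union R of
    the radicals of the finite subsystems of S, which always lies in Qvar(B),
    this says that R contains every consequence of S: a homomorphism to B that
    separates two classes is a solution of S refuting the corresponding equation.
    That is compactness; the converse takes S to be all equations satisfied by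
    the given generators.

    Independently of compactness, Qvar(B) = L SP(B) = Ls SP(B): an algebra C of
    Qvar(B) is the limit of T(C)/Rad(F), for F the finite sets of equations true
    in C, taking the elements of C as variables. This handles 8 and 9; the same
    system, for variables x_1, ..., x_n and finite F contained in S, handles 11
    and 12. *)
Require Import Defs.
From HB Require Import structures.
From mathcomp Require Import all_boot all_order.
From mathcomp Require Import boolp classical_sets functions cardinality.

Set Implicit Arguments.
Unset Strict Implicit.
Unset Printing Implicit Defensive.

Local Open Scope classical_set_scope.
Local Open Scope quotient_scope.

(** * Homomorphisms, isomorphisms and embeddings *)

Section Homs.
Variable L : language.
Implicit Types A B C : algebra L.

Lemma hom_comp A B C (g : B -> C) (h : A -> B) : hom g -> hom h -> hom (g \o h).
Proof. by move=> gh hh f a; rewrite /= hh gh. Qed.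

Lemma hom_can A B (h : A -> B) (g : B -> A) :
  hom h -> cancel h g -> cancel g h -> hom g.
Proof.
move=> hh hK gK f b; rewrite -[RHS]hK hh; congr (g (op B f _)).
by apply: funext => i /=; rewrite gK.
Qed.

Lemma isomorphic_refl A : isomorphic A A.
Proof. by exists id => //; exists id. Qed.

Lemma isomorphic_sym A B : isomorphic A B -> isomorphic B A.
Proof.
move=> [h hh [g hK gK]]; exists g; first exact: hom_can hh hK gK.
by exists h.
Qed.

Lemma isomorphic_trans A B C :
  isomorphic A B -> isomorphic B C -> isomorphic A C.
Proof.
move=> [h hh hb] [g gh gb]; exists (g \o h); first exact: hom_comp.
exact: bij_comp.
Qed.

Lemma inj_surj_isomorphic A B (h : A -> B) :
  hom h -> injective h -> Defs.surj h -> isomorphic A B.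
Proof.
move=> hh hi hs; have gP b := projT2 (cid (hs b)).
exists h => //; exists (fun b => projT1 (cid (hs b))) => [a|b]; last exact: gP.
exact/hi/gP.
Qed.

Lemma eval_hom A B (h : A -> B) (X : Type) (v : X -> A) (t : term L X) :
  hom h -> h (eval v t) = eval (h \o v) t.
Proof.
move=> hh; elim: t => //= f a IH; rewrite hh; congr (op B f _).
exact: funext.
Qed.

Lemma satisfies_hom n A B (h : A -> B) (v : 'I_n -> A) (e : equation L n) :
  hom h -> satisfies v e -> satisfies (h \o v) e.
Proof. by move=> hh ve; rewrite /satisfies -!eval_hom// ve. Qed.

Lemma holds_inj n (phi : implication L n) A B (h : A -> B) :
  hom h -> injective h -> holds B phi -> holds A phi.
Proof.
move=> hh hi Bphi v vS; apply: hi; rewrite !eval_hom//; apply: Bphi => e eS.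
exact/satisfies_hom/vS.
Qed.

Lemma range_op_closed A B (h : A -> B) : hom h -> op_closed (range h).
Proof.
move=> hh f a ra; exists (op A f (fun i => projT1 (cid2 (ra i)))) => //.
by rewrite hh; congr (op B f _); apply: funext => i /=; case: (cid2 (ra i)).
Qed.

Lemma range_nonempty A B (h : A -> B) : range h !=set0.
Proof. by case: (algebra_inhabited A) => a; exists (h a), a. Qed.

Lemma val_hom A (D : subalgebra A) : hom (val : sub_algebra D -> A).
Proof. by []. Qed.

Lemma embedding_opS (K : algebra_class L) A B (h : A -> B) :
  hom h -> injective h -> K B -> opS K A.
Proof.
move=> hh hi KB; exists B => //.
pose D := Subalgebra (range_op_closed hh) (range_nonempty h); exists D.
pose g (a : A) : sub_algebra D := exist _ (h a) (mem_set (imageP h I)).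
apply: (@inj_surj_isomorphic _ _ g) => [f a|a b /(congr1 val)/hi//|[b bD]].
  by apply: val_inj; rewrite /= hh.
by have [a _ hab] := set_mem bD; exists a; apply: val_inj.
Qed.

End Homs.

(** * Terms, substitution and finite generation *)

Section Terms.
Variable L : language.

Fixpoint subst (X Y : Type) (s : X -> term L Y) (t : term L X) : term L Y :=
  match t with
  | Var x => s x
  | App f a => App f (fun i => subst s (a i))
  end.

Lemma eval_subst (X Y : Type) (s : X -> term L Y) (B : algebra L) (v : Y -> B) t :
  eval v (subst s t) = eval (fun x => eval v (s x)) t.
Proof. by elim: t => //= f a IH; congr (op B f _); exact: funext. Qed.

Fixpoint vars (X : Type) (t : term L X) : set X :=
  match t with
  | Var x => [set x]
  | App f a => \bigcup_i vars (a i)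
  end.

Lemma finite_vars (X : Type) (t : term L X) : finite_set (vars t).
Proof.
elim: t => [x|f a IH] /=; first exact: finite_set1.
by apply: bigcup_finite => // i _; exact: IH.
Qed.

Lemma eq_eval (X : Type) (B : algebra L) (v w : X -> B) (t : term L X) :
  {in vars t, v =1 w} -> eval v t = eval w t.
Proof.
elim: t => [x|f a IH] /= vw; first by apply: vw; rewrite inE.
congr (op B f _); apply: funext => i; apply: IH => x /set_mem xi.
by apply: vw; apply/mem_set; exists i.
Qed.

(** Quasi-identities have variables in some ['I_n]: [r] renames the variables in [F] to such
    indices, and [g] undoes the renaming. *)
Lemma finite_reindexing (X : Type) (F : set X) : inhabited X -> finite_set F ->
  exists n (g : 'I_n -> X) (r : X -> 'I_n), {in F, cancel r g}.
Proof.
move=> [x0] finF.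
have [s Fs] : exists s : seq {classic X}, F = [set` s] by exact/finite_seqP.
(* The extra index makes [inord] available and receives every [x] outside the list; there [g] takes
   the default [x0]. *)
exists (size s).+1, (fun i => nth (x0 : {classic X}) s i).
exists (fun x => inord (index (x : {classic X}) s)) => x.
rewrite Fs inE /= => xs; rewrite inordK ?nth_index//.
by rewrite ltnS index_size.
Qed.

Lemma finite_set_range_ord (A : Type) (G : set A) :
  finite_set G -> exists n (x : 'I_n -> A), range x = G.
Proof.
move=> finG.
have [s ->] : exists s : seq {classic A}, G = [set` s] by exact/finite_seqP.
exists (size s), (fun i => tnth (in_tuple s) i); apply/seteqP; split=> y /=.
  by move=> [i _ <-]; exact: mem_tnth.
by case/(nthP (y : {classic A})) => i si <-; exists (Ordinal si) => //; exact: tnth_nth.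
Qed.

Lemma op_closed_eval (X : Type) (A : algebra L) (D : set A) (x : X -> A) t :
  op_closed D -> range x `<=` D -> D (eval x t).
Proof.
by move=> Dop xD; elim: t => [y|f a IH] /=; [exact/xD/imageP|exact: Dop].
Qed.

Lemma op_closed_range_eval (X : Type) (A : algebra L) (x : X -> A) :
  op_closed (range (eval x)).
Proof.
move=> f a ra; exists (App f (fun i => projT1 (cid2 (ra i)))) => //=.
by congr (op A f _); apply: funext => i; case: (cid2 (ra i)).
Qed.

(** The values of terms at [x] form a closed set containing the generators, and every such set
    contains them by induction on terms. *)
Lemma generated_range (X : Type) (A : algebra L) (x : X -> A) :
  generated (range x) = range (eval x).
Proof.
apply/seteqP; split=> [y /(_ (range (eval x)))|y [t _ <-] D [Dop xD]].
  by apply; split=> [|_ [i _ <-]]; [exact: op_closed_range_eval|exists (Var i)].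
exact: op_closed_eval.
Qed.

Definition generates (X : Type) (A : algebra L) (x : X -> A) : Prop :=
  forall a, exists t, eval x t = a.

Lemma finitely_generatedP (A : algebra L) :
  finitely_generated A <-> exists n (x : 'I_n -> A), generates x.
Proof.
split=> [[G /finite_set_range_ord[n [x <-]]]|[n [x gx]]].
  rewrite generated_range => gx; exists n, x => a.
  by have : [set: A] a by []; rewrite -gx => -[t _ ta]; exists t.
exists (range x); first exact/finite_image/finite_finset.
rewrite generated_range -subTset => a _.
by have [t ta] := gx a; exists t.
Qed.

Lemma surj_finitely_generated (A B : algebra L) (h : A -> B) :
  hom h -> Defs.surj h -> finitely_generated A -> finitely_generated B.
Proof.
move=> hh hs /finitely_generatedP[n [x gx]]; apply/finitely_generatedP.
exists n, (h \o x) => b; have [a <-] := hs b; have [t <-] := gx a.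
by exists t; rewrite eval_hom.
Qed.

Lemma iso_finitely_generated (A B : algebra L) :
  isomorphic A B -> finitely_generated A -> finitely_generated B.
Proof.
move=> [h hh [g hK gK]]; apply: (surj_finitely_generated hh) => b.
by exists (g b).
Qed.

Lemma subst_Var (X : Type) (t : term L X) : subst Var t = t.
Proof. by elim: t => //= f a IH; congr App; exact: funext. Qed.

Lemma eval_term_algebra (X Y : Type) (T0 : inhabited (term L X))
    (s : Y -> term L X) (t : term L Y) :
  eval (B := term_algebra T0) s t = subst s t.
Proof. by elim: t => //= f a IH; congr App; exact: funext. Qed.

End Terms.

(** * The homomorphism theorem for quotient algebras *)

Section Kernel.
Variables (L : language) (A C : algebra L) (theta : congruence A).

Lemma quot_surj (x : quot_algebra theta) : exists a, quot_class theta a = x.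
Proof.
by exists (repr (x : {eq_quot quot_equiv theta})); rewrite /quot_class reprK.
Qed.

Variables (h : A -> C) (hh : hom h) (hker : forall x y, theta x y -> h x = h y).

Definition quot_lift (x : quot_algebra theta) : C :=
  h (repr (x : {eq_quot quot_equiv theta}) : A).

Lemma quot_lift_class a : quot_lift (quot_class theta a) = h a.
Proof. by apply/hker/quot_classP; rewrite /quot_class reprK. Qed.

Lemma quot_lift_hom : hom quot_lift.
Proof.
move=> f a; rewrite {2}/quot_lift /= -hh; exact: quot_lift_class.
Qed.

(** First isomorphism theorem: with [hker], the last hypothesis makes [theta] exactly the kernel of
    [h]. *)
Lemma ker_isomorphic :
  Defs.surj h -> (forall x y, h x = h y -> theta x y) ->
  isomorphic (quot_algebra theta) C.
Proof.
move=> hs hinj; apply: (inj_surj_isomorphic quot_lift_hom) => [x y|c].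
  have [a <-] := quot_surj x; have [b <-] := quot_surj y.
  by rewrite !quot_lift_class => /hinj/quot_classP.
by have [a <-] := hs c; exists (quot_class theta a); exact: quot_lift_class.
Qed.

End Kernel.

(** * Separation by [B], Pvar(B), Qvar(B) and coordinate algebras *)

Section Separation.
Variables (L : language) (B : algebra L).
Implicit Types A C : algebra L.

Lemma Res_inj A C (h : A -> C) : hom h -> injective h -> Res B C -> Res B A.
Proof.
move=> hh hi CB c1 c2 c12.
have [|g gh g12] := CB (h c1) (h c2); first by move/hi.
by exists (g \o h) => //; exact: hom_comp.
Qed.

Lemma Res_iso A C : isomorphic A C -> Res B C -> Res B A.
Proof. by move=> [h hh /bij_inj hi]; exact: Res_inj hh hi. Qed.

Lemma class_of_Res : class_incl (class_of B) (Res B).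
Proof.
move=> C [h hh /bij_inj hi] c1 c2 c12; exists h => //.
by move=> /hi.
Qed.

(** For a subalgebra, restrict the separating homomorphism; in a product, project first to a
    coordinate where the elements differ. *)
Lemma Res_prevariety : prevariety (Res B).
Proof.
split=> C [].
  move=> A AB [D CD]; apply: (Res_iso CD); apply: Res_inj AB.
    exact: val_hom.
  exact: val_inj.
move=> J [A [AB CA]]; apply: (Res_iso CA) => c1 c2 c12.
have [i c12i] : exists i, c1 i <> c2 i.
  by apply/existsNP => c12E; apply: c12; exact: functional_extensionality_dep.
have [h hh h12] := AB i _ _ c12i.
by exists (fun c => h (c i)) => // f a; rewrite /= hh.
Qed.

(** A separated [C] embeds into the power of [B] indexed by all homomorphisms from [C] to [B];
    conversely, [Res B] is a prevariety containing [B]. *)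
Lemma ResE : class_eq (Res B) (opS (opP (class_of B))).
Proof.
move=> C; split=> [CB|].
  pose J := {h : C -> B | hom h}.
  apply: (@embedding_opS _ _ _ (prod_algebra (fun _ : J => B))
    (fun c i => projT1 i c)).
  - by move=> f a; apply: functional_extensionality_dep => -[h hh] /=; rewrite hh.
  - move=> c1 c2 c12; apply: contrapT => /CB[h hh]; apply.
    exact: (congr1 (fun p : J -> B => p (exist _ h hh)) c12).
  - exists J, (fun _ => B); split=> [_|]; exact: isomorphic_refl.
have [RS RP] := Res_prevariety.
move=> [A [J [F [FB AF]]] D]; apply: RS; exists A => //; apply: RP.
by exists J, F; split=> // j; exact: class_of_Res.
Qed.

Lemma PvarE : class_eq (Pvar (class_of B)) (Res B).
Proof.
move=> C; split; first by apply; [exact: Res_prevariety|exact: class_of_Res].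
move=> /ResE[A [J [F [FB AF]]] D] K [KS KP] BK; apply: KS; exists A => //.
by apply: KP; exists J, F; split=> // j; exact: BK.
Qed.

(** Isomorphic copies of [B] satisfy the same implications, so only [B] itself has to be tested. *)
Lemma QvarP C : Qvar (class_of B) C <->
  forall n (phi : implication L n), quasi_identity phi -> holds B phi ->
    holds C phi.
Proof.
split=> QC n phi qphi Bphi; apply: QC => //; last exact/Bphi/isomorphic_refl.
by move=> A [h hh /bij_inj hi]; exact: holds_inj hh hi Bphi.
Qed.

(** A homomorphism separating the two sides of the conclusion carries a counterexample in [C] to one
    in [B]. *)
Lemma Res_holds C n (phi : implication L n) : Res B C -> holds B phi -> holds C phi.
Proof.
move=> CB Bphi v vS; apply: contrapT => /CB[h hh]; apply.
rewrite !eval_hom//; apply: Bphi => e eS.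
exact/satisfies_hom/vS.
Qed.

Lemma Res_Qvar : class_incl (Res B) (Qvar (class_of B)).
Proof. by move=> C CB; apply/QvarP => n phi _; exact: Res_holds. Qed.

Lemma Qvar_inj A C (h : A -> C) :
  hom h -> injective h -> Qvar (class_of B) C -> Qvar (class_of B) A.
Proof.
move=> hh hi /QvarP QC; apply/QvarP => n phi qphi Bphi.
exact: (holds_inj hh hi (QC n phi qphi Bphi)).
Qed.

(** An implication at [v] can be tested in the subalgebra generated by the values of [v], which is
    finitely generated and so separated. *)
Lemma Lfg_Res_Qvar : class_incl (opLfg (Res B)) (Qvar (class_of B)).
Proof.
move=> C LC; apply/QvarP => n phi _ Bphi v vS.
(* The conclusion of [phi] supplies a term, so this set is nonempty even if [n] is 0. *)
pose D := Subalgebra (@op_closed_range_eval _ _ _ v)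
  (ex_intro _ _ (imageP (eval v) (I : setT (conclusion phi).1))).
pose u i : sub_algebra D := exist _ (v i) (mem_set (imageP (eval v) (I : setT (Var i)))).
have vu : v = val \o u by [].
have genu : generates u.
  move=> a; have [t _ ta] := set_mem (valP a); exists t; apply: val_inj.
  by rewrite (eval_hom _ _ (@val_hom _ _ D)).
have DB : Res B (sub_algebra D).
  by apply: LC; apply/finitely_generatedP; exists n, u.
rewrite vu /satisfies -!eval_hom; try exact: val_hom.
congr val; apply: (Res_holds DB Bphi) => e eS; apply: val_inj.
by rewrite !(eval_hom _ _ (@val_hom _ _ D)) -vu; exact: vS.
Qed.

Lemma coordinate_algebraP C :
  coordinate_algebra B C <-> finitely_generated C /\ Res B C.
Proof.
split=> [[n [T0 [Y [_ CY]]]]|[/finitely_generatedP[n [x gx]] CB]].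
  pose pi := quot_class (theta_congruence T0 Y).
  have pih : hom (pi : term_algebra T0 -> Gamma T0 Y) by exact: quot_class_hom.
  split.
    apply: (iso_finitely_generated (isomorphic_sym CY)).
    apply/finitely_generatedP; exists n, (pi \o Var) => c.
    have [t <-] := quot_surj c; exists t.
    by rewrite -(eval_hom _ _ pih) eval_term_algebra subst_Var.
  apply: (Res_iso CY) => c1 c2.
  have [t1 <-] := quot_surj c1; have [t2 <-] := quot_surj c2 => t12.
  (* Evaluation at a point of [Y] where the terms differ factors through the coordinate algebra and
     separates the classes. *)
  have [v Yv v12] : exists2 v, Y v & eval v t1 <> eval v t2.
    apply: contrapT => nv; apply/t12/quot_classP/rad_ofP => v Yv.
    by apply: contrapT => v12; apply: nv; exists v.
  have vE t s : theta_congruence T0 Y t s -> eval v t = eval v s.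
    by move=> /rad_ofP; exact.
  exists (quot_lift (C := B) (theta := theta_congruence T0 Y) (eval v)).
    exact: quot_lift_hom vE.
  by rewrite !(quot_lift_class vE).
have T0 : inhabited (term L 'I_n).
  by have [c] := algebra_inhabited C; have [t _] := gx c; exists.
(* All relations between the generators. Since [B] separates [C], this set is its own radical, and
   its congruence is the kernel of [eval x]. *)
pose S := [set e : equation L n | satisfies x e].
exists n, T0, (solutions S); split; first by exists S.
apply: isomorphic_sym; apply: (@ker_isomorphic _ _ _ (theta_congruence T0 _) (eval x)) => //.
- move=> t s /rad_ofP ts; apply: contrapT => /CB[h hh]; apply.
  by rewrite !eval_hom//; apply: ts => e eS; rewrite /satisfies -!eval_hom// eS.
- by move=> t s ts; apply/rad_ofP => v vS; exact: (vS (t, s)).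
Qed.

End Separation.

(** * Consequences over [B] in an arbitrary set of variables *)

Section Consequences.
Variables (L : language) (B : algebra L) (X : Type).
Implicit Types E F R : set (term L X * term L X).

Definition models (A : algebra L) (v : X -> A) E : Prop :=
  forall e, E e -> eval v e.1 = eval v e.2.

(** The radical of [E], but with variables from any type, since the elements of an algebra will
    serve as variables; [radicalE] identifies the two for ['I_n]. *)
Definition consequences E : set (term L X * term L X) :=
  [set e | forall v : X -> B, models v E -> eval v e.1 = eval v e.2].

Definition fin_consequences E : set (term L X * term L X) :=
  \bigcup_(F in [set F | finite_set F /\ F `<=` E]) consequences F.

Lemma sub_consequences E : E `<=` consequences E.
Proof. by move=> e Ee v; exact. Qed.

Lemma consequences_sub E F : E `<=` consequences F ->
  consequences E `<=` consequences F.
Proof. by move=> EF e Ee v vF; apply: Ee => d /EF; exact. Qed.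

Lemma consequencesS E F : E `<=` F -> consequences E `<=` consequences F.
Proof. by move=> EF; apply: consequences_sub => e /EF; exact: sub_consequences. Qed.

Lemma sub_fin_consequences E : E `<=` fin_consequences E.
Proof.
move=> e Ee; exists [set e]; last exact: sub_consequences.
by split=> [|_ ->//]; exact: finite_set1.
Qed.

(** Closure under the quasi-identities of [B]; this makes [R] a congruence with quotient in
    Qvar(B). *)
Definition consequence_closed R : Prop :=
  forall F, finite_set F -> F `<=` R -> consequences F `<=` R.

Lemma consequences_closed E : consequence_closed (consequences E).
Proof. by move=> F _ /consequences_sub. Qed.

(** Each of the finitely many equations [d] in [F] follows from a finite part [G d] of [E], and the
    union of these parts is finite. *)
Lemma fin_consequences_closed E : consequence_closed (fin_consequences E).
Proof.
move=> F finF FE e Fe; pose G d := if pselect (F d) is left Fd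
  then projT1 (cid2 (FE d Fd)) else set0.
have GP d : F d -> [/\ finite_set (G d), G d `<=` E & consequences (G d) d].
  by rewrite /G; case: pselect => // Fd _; case: cid2 => ? [].
exists (\bigcup_(d in F) G d).
  split=> [|x [d /GP[_ + _]]]; last exact.
  by apply: bigcup_finite => // d /GP[].
apply: consequences_sub Fe => d Fd; have [_ _] := GP d Fd.
by apply: consequencesS => x Gx; exists d.
Qed.

(** * Quotients of the term algebra by closed sets of equations *)

Section Congruence.
Variables (T0 : inhabited (term L X)) (R : set (term L X * term L X)).
Hypothesis Rcl : consequence_closed R.
Let T := term_algebra T0.

(** Each congruence law, here and in the next three lemmas, is a quasi-identity true in every
    algebra, so closure yields it. *)
Lemma closed_refl (t : T) : R (t, t).
Proof. by apply: (Rcl (finite_set0 _)) => // e []. Qed.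

Lemma closed_sym (t s : T) : R (t, s) -> R (s, t).
Proof.
move=> ts; apply: (Rcl (finite_set1 (t, s))) => [_ ->//|v vE].
by rewrite (vE (t, s)).
Qed.

Lemma closed_trans (t s u : T) : R (t, s) -> R (s, u) -> R (t, u).
Proof.
move=> ts su; apply: (Rcl (finite_set2 (t, s) (s, u))) => [_ [->|->]//|v vE].
by rewrite /= (vE (t, s)) ?(vE (s, u)); [|right|left].
Qed.

Lemma closed_op (f : L) (a b : 'I_(arity f) -> T) :
  (forall i, R (a i, b i)) -> R (op T f a, op T f b).
Proof.
move=> ab; have finF : finite_set (range (fun i => (a i, b i))).
  exact/finite_image/finite_finset.
apply: (Rcl finF) => [_ [i _ <-]//|v vE] /=; congr (op B f _).
by apply: funext => i; apply: (vE (a i, b i)); exists i.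
Qed.

Definition closed_congruence : congruence T :=
  @Congruence _ T (fun t s => R (t, s)) closed_refl closed_sym closed_trans closed_op.

Lemma eval_quot_class Y (v : Y -> term L X) (t : term L Y) :
  eval (B := quot_algebra closed_congruence)
    (fun y => quot_class closed_congruence (v y)) t
  = quot_class closed_congruence (subst v t).
Proof.
by rewrite -(eval_hom _ _ (@quot_class_hom _ _ closed_congruence)) eval_term_algebra.
Qed.

Lemma closed_quot_generates : generates (A := quot_algebra closed_congruence)
  (fun x => quot_class closed_congruence (Var x)).
Proof.
by move=> a; have [t <-] := quot_surj a; exists t; rewrite eval_quot_class subst_Var.
Qed.

(** Representatives of the values of [v] turn the premises into finitely many equations of [R], and
    the conclusion into a consequence of them. *)
Lemma closed_quot_Qvar : Qvar (class_of B) (quot_algebra closed_congruence).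
Proof.
apply/QvarP => n phi finphi Bphi v.
pose r i : term L X := projT1 (cid (quot_surj (v i))).
have -> : v = fun i => quot_class closed_congruence (r i).
  by apply: funext => i; rewrite /r; case: cid.
move=> vS; pose s (e : equation L n) := (subst r e.1, subst r e.2).
have sE e : satisfies (B := quot_algebra closed_congruence)
    (fun i => quot_class closed_congruence (r i)) e <-> R (s e).
  by rewrite /satisfies !eval_quot_class; exact: quot_classP.
apply/sE; have finF := finite_image s finphi.
apply: (Rcl finF) => [_ [e /vS eS <-]|w wF]; first exact/sE.
rewrite !eval_subst; apply: Bphi => e eS.
by rewrite /satisfies -!eval_subst; apply: (wF (s e)); exists e.
Qed.

(** A homomorphism to [B] separating two classes, read on the classes of the variables, is a model
    of [E] at which the terms differ. *)
Lemma quot_Res_consequences E :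
  E `<=` R -> Res B (quot_algebra closed_congruence) -> consequences E `<=` R.
Proof.
move=> ER QB [t s] Ets; apply: contrapT => nR.
have [|h hh] := QB (quot_class closed_congruence t) (quot_class closed_congruence s).
  by move=> /quot_classP.
have hE u : h (quot_class closed_congruence u) =
    eval (fun x => h (quot_class closed_congruence (Var x))) u.
  by rewrite -{1}[u]subst_Var -eval_quot_class eval_hom.
rewrite !hE; apply; apply: (Ets) => -[u w] /ER Ruw /=.
by rewrite -!hE; congr h; apply/quot_classP.
Qed.

End Congruence.

(** Terms in distinct classes differ at some model of [E] in [B], and evaluation at that model
    respects the congruence. *)
Lemma consequences_quot_Res (T0 : inhabited (term L X)) R E
    (Rcl : consequence_closed R) : R = consequences E ->
  Res B (quot_algebra (closed_congruence T0 Rcl)).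
Proof.
move=> RE c1 c2.
have [t1 <-] := quot_surj c1; have [t2 <-] := quot_surj c2 => t12.
have [v vE v12] : exists2 v : X -> B, models v E & eval v t1 <> eval v t2.
  apply: contrapT => nv; apply/t12/quot_classP; rewrite /= RE => v vE.
  by apply: contrapT => v12; apply: nv; exists v.
have vR t s : closed_congruence T0 Rcl t s -> eval v t = eval v s.
  by rewrite /= RE; exact.
exists (quot_lift (C := B) (theta := closed_congruence T0 Rcl) (eval v)).
  exact: quot_lift_hom vR.
by rewrite !(quot_lift_class vR).
Qed.

End Consequences.

(** * Quasi-identities in direct limits *)

Section DirectLimits.
Variables (L : language) (d : Order.disp_t) (I : porderType d) (dirI : directed I).

Lemma directed_finite (T : Type) (F : set T) (Q : T -> I -> Prop) :
  finite_set F -> (forall e i j, (i <= j)%O -> Q e i -> Q e j) ->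
  (forall e, F e -> exists i, Q e i) -> exists i, forall e, F e -> Q e i.
Proof.
move=> /finite_set_range_ord[n [x <-]] Qmono Qex.
have k a : {i | Q (x a) i} by apply/cid/Qex/imageP.
have [i ki] := upper_bound dirI (fun a => projT1 (k a)).
by exists i => _ [a _ <-]; apply: Qmono (ki a) _; exact: projT2.
Qed.

Variable Lam : direct_system L I.

Lemma lim_inj_surj (y : direct_limit Lam dirI) :
  exists i x, lim_inj dirI (i := i) x = y.
Proof.
case E : (repr (y : {eq_quot lim_equiv Lam dirI})) => [i x]; exists i, x.
by rewrite /lim_inj -E reprK.
Qed.

Lemma lim_inj_tr (i j : I) (ij : (i <= j)%O) (x : obj Lam i) :
  lim_inj dirI (tr Lam ij x) = lim_inj dirI x.
Proof.
apply/lim_injP; exists j, (Order.POrderTheory.lexx j), ij.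
by rewrite tr_id.
Qed.

Lemma lim_inj_finite n (v : 'I_n -> direct_limit Lam dirI) :
  exists j (w : 'I_n -> obj Lam j), v = @lim_inj _ _ _ Lam dirI j \o w.
Proof.
pose i k := cid (lim_inj_surj (v k)).
pose x k := cid (projT2 (i k)).
have [j ij] := upper_bound dirI (fun k => projT1 (i k)).
exists j, (fun k => tr Lam (ij k) (projT1 (x k))); apply: funext => k /=.
by rewrite lim_inj_tr; exact/esym/(projT2 (x k)).
Qed.

(** The finitely many values and premises are realized at a single stage, where [phi] applies; the
    conclusion is then sent to the limit. *)
Lemma direct_limit_holds n (phi : implication L n) : quasi_identity phi ->
  (forall i, holds (obj Lam i) phi) -> holds (direct_limit Lam dirI) phi.
Proof.
move=> finphi Hphi v vS; have [j [w vE]] := lim_inj_finite v.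
pose Q (e : equation L n) k := exists jk : (j <= k)%O, satisfies (tr Lam jk \o w) e.
have [e k l kl [jk]|e eS|k kQ] := directed_finite (Q := Q) finphi.
- have jl := Order.POrderTheory.le_trans jk kl.
  exists jl; have -> : tr Lam jl \o w = tr Lam kl \o (tr Lam jk \o w).
    by apply: funext => a /=; rewrite (tr_comp jk kl jl).
  by apply: satisfies_hom => //; exact: tr_hom.
- have := vS e eS; rewrite /satisfies vE -!eval_hom; try exact: lim_inj_hom.
  move=> /lim_injP[k [jk [jk']]]; rewrite (bool_irrelevance jk' jk) => eE.
  by exists k, jk; rewrite /satisfies -!eval_hom//; exact: tr_hom.
(* Without premises [k] need not lie above [j], hence the common bound [m]. *)
have [m [jm km]] := dirI.2 j k.
have -> : v = @lim_inj _ _ _ Lam dirI m \o (tr Lam jm \o w).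
  by rewrite vE; apply: funext => a /=; rewrite lim_inj_tr.
apply: satisfies_hom; first exact: lim_inj_hom.
apply: Hphi => e /kQ[jk eE].
have -> : tr Lam jm \o w = tr Lam km \o (tr Lam jk \o w).
  by apply: funext => a /=; rewrite (tr_comp jk km jm).
by apply: satisfies_hom => //; exact: tr_hom.
Qed.

End DirectLimits.

(** * The direct system of quotients by radicals of finite subsystems *)

Section RadicalSystem.
Variables (L : language) (B : algebra L) (X : Type).
Variable E : set (term L X * term L X).

(* The index set consists of radicals rather than of finite subsystems, since
   condition 11 requires the order to coincide with inclusion. *)
Definition finitely_based : set (set (term L X * term L X)) :=
  [set R | exists2 F, finite_set F /\ F `<=` E & R = consequences B F].

Definition radical_index := {R : set (term L X * term L X) | R \in finitely_based}.

HB.instance Definition _ := SubChoice.on radical_index.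
HB.instance Definition _ :=
  [SubChoice_isSubPOrder of radical_index by <: with set_display].

Lemma radical_index_le (i j : radical_index) : (i <= j)%O <-> val i `<=` val j.
Proof. by rewrite -subsetEset Order.le_val. Qed.

Definition to_radical_index F (finF : finite_set F) (FE : F `<=` E) :
    radical_index :=
  exist _ (consequences B F) (mem_set (ex_intro2 _ _ F (conj finF FE) erefl)).

Lemma radical_index_directed : directed radical_index.
Proof.
split; first exact: (inhabits (to_radical_index (@finite_set0 _) (@sub0set _ E))).
move=> [R Rf] [R' Rf'].
have [F [finF FE] RF] := set_mem Rf; have [F' [finF' FE'] RF'] := set_mem Rf'.
have finU : finite_set (F `|` F') by rewrite finite_setU.
have UE : F `|` F' `<=` E by move=> e [/FE|/FE'].
exists (to_radical_index finU UE); split; apply/radical_index_le => /=.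
  by rewrite RF; apply: consequencesS => e; left.
by rewrite RF'; apply: consequencesS => e; right.
Qed.

Lemma radical_index_cover (e : term L X * term L X) :
  fin_consequences B E e <-> exists i : radical_index, val i e.
Proof.
split=> [[F [finF FE] Fe]|[[R Rf] /=]]; first by exists (to_radical_index finF FE).
by have [F FE ->] := set_mem Rf; exists F.
Qed.

Lemma radical_index_closed (i : radical_index) : consequence_closed B (val i).
Proof.
by have [F _ ->] := set_mem (valP i); exact: consequences_closed.
Qed.

Variable T0 : inhabited (term L X).

Definition radical_congruence (i : radical_index) : congruence (term_algebra T0) :=
  closed_congruence T0 (@radical_index_closed i).

Definition radical_obj (i : radical_index) : algebra L :=
  quot_algebra (radical_congruence i).

Lemma radical_obj_Res i : Res B (radical_obj i).
Proof.
have [F _ iF] := set_mem (valP i); exact: consequences_quot_Res iF.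
Qed.

(** Induced by the identity on terms: a larger radical gives a coarser congruence. *)
Definition radical_tr (i j : radical_index) (_ : (i <= j)%O) :
    radical_obj i -> radical_obj j :=
  quot_lift (C := radical_obj j) (theta := radical_congruence i)
    (quot_class (radical_congruence j)).

Lemma radical_tr_class (i j : radical_index) (ij : (i <= j)%O) t :
  radical_tr ij (quot_class (radical_congruence i) t) =
  quot_class (radical_congruence j) t.
Proof.
apply: (@quot_lift_class _ _ (radical_obj j)) => a b ab; apply/quot_classP.
by move/radical_index_le : ij; exact.
Qed.

Lemma radical_tr_hom (i j : radical_index) (ij : (i <= j)%O) : hom (radical_tr ij).
Proof.
apply: quot_lift_hom => [|a b ab]; first exact: quot_class_hom.
by apply/quot_classP; move/radical_index_le : ij; exact.
Qed.

Lemma radical_tr_id (i : radical_index) (ii : (i <= i)%O) (x : radical_obj i) :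
  radical_tr ii x = x.
Proof. by have [t <-] := quot_surj x; exact: radical_tr_class. Qed.

Lemma radical_tr_comp (i j k : radical_index) (ij : (i <= j)%O) (jk : (j <= k)%O)
  (ik : (i <= k)%O) (x : radical_obj i) :
  radical_tr jk (radical_tr ij x) = radical_tr ik x.
Proof. by have [t <-] := quot_surj x; rewrite !radical_tr_class. Qed.

Definition radical_system : direct_system L radical_index :=
  DirectSystem radical_tr_hom radical_tr_id radical_tr_comp.

Lemma radical_system_epimorphic : epimorphic radical_system.
Proof.
move=> i j ij x; have [t <-] := quot_surj x.
exists (quot_class (radical_congruence i) t); exact: radical_tr_class.
Qed.

(** Two terms become equal in the limit exactly when some radical of the system contains their
    equation, that is, when it follows from a finite part of [E]. *)
Lemma radical_system_limit :
  isomorphic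
    (quot_algebra (closed_congruence T0 (@fin_consequences_closed _ B X E)))
    (direct_limit radical_system radical_index_directed).
Proof.
pose dirI := radical_index_directed.
have [i0] := dirI.1.
pose lim i (t : term_algebra T0) : direct_limit radical_system dirI :=
  lim_inj (Lam := radical_system) dirI (quot_class (radical_congruence i) t).
have limE i j t : lim i t = lim j t.
  have [k [ik jk]] := dirI.2 i j.
  by apply/lim_injP; exists k, ik, jk; rewrite /= !radical_tr_class.
have lim_eq i t s : lim i t = lim i s <-> fin_consequences B E (t, s).
  rewrite radical_index_cover; split=> [/lim_injP[k [ik [ik']]]|[k kts]].
    by rewrite /= !radical_tr_class => /quot_classP; exists k.
  by rewrite !(limE i k); congr lim_inj; exact/quot_classP.
apply: (@ker_isomorphic _ _ _ _ (lim i0)).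
- exact: hom_comp (@lim_inj_hom _ _ _ radical_system dirI i0) (@quot_class_hom _ _ _).
- by move=> t s ts; apply/lim_eq.
- move=> y; have [i [x <-]] := lim_inj_surj y; have [t <-] := quot_surj x.
  by exists t; exact: limE.
- by move=> t s /lim_eq.
Qed.

End RadicalSystem.

(** * Qvar(B) as a class of limits, and its finitely generated members *)

Section Classes.
Variables (L : language) (B : algebra L).

Lemma opLS (K K' : algebra_class L) : class_incl K K' -> class_incl (opL K) (opL K').
Proof.
move=> KK' C [d [I [Lam [dirI [LK CL]]]]]; exists d, I, Lam, dirI.
by split=> // i; exact: KK'.
Qed.

Lemma opLsS (K K' : algebra_class L) :
  class_incl K K' -> class_incl (opLs K) (opLs K').
Proof.
move=> KK' C [d [I [Lam [dirI [LK Lepi CL]]]]]; exists d, I, Lam, dirI.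
by split=> // i; exact: KK'.
Qed.

Lemma opLs_opL (K : algebra_class L) : class_incl (opLs K) (opL K).
Proof.
move=> C [d [I [Lam [dirI [LK _ CL]]]]]; exists d, I, Lam, dirI.
by split.
Qed.

Lemma opLfgS (K K' : algebra_class L) :
  class_incl K K' -> class_incl (opLfg K) (opLfg K').
Proof. by move=> KK' C CK D /CK/KK'. Qed.

Lemma opL_Res_Qvar : class_incl (opL (Res B)) (Qvar (class_of B)).
Proof.
move=> C [d [I [Lam [dirI [LB [h hh /bij_inj hi]]]]]].
apply: (Qvar_inj hh hi); apply/QvarP => n phi finphi Bphi.
by apply: direct_limit_holds => // i; exact: Res_holds Bphi.
Qed.

(** That [F] implies [c] over [B] is a quasi-identity of [B] once the finitely many variables
    involved are renamed, so it passes to [C]. *)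
Lemma Qvar_consequences (C : algebra L) (X : Type) (x : X -> C) (c : term L X * term L X)
    (F : set (term L X * term L X)) :
  inhabited X -> Qvar (class_of B) C -> finite_set F -> models x F ->
  consequences B F c -> eval x c.1 = eval x c.2.
Proof.
move=> X0 /QvarP QC finF xF Fc.
pose V (e : term L X * term L X) := vars e.1 `|` vars e.2.
pose W := \bigcup_(e in c |` F) V e.
have finW : finite_set W.
  apply: bigcup_finite => [|e _]; first by rewrite finite_setU; split; [exact: finite_set1|].
  by rewrite finite_setU; split; exact: finite_vars.
have [n [g [r gr]]] := finite_reindexing X0 finW.
pose s (e : term L X * term L X) : equation L n :=
  (subst (Var \o r) e.1, subst (Var \o r) e.2).
(* Evaluation at [x \o g] undoes the renaming, as [g] inverts [r] on [W]. *)
have sE e : (c |` F) e -> satisfies (x \o g) (s e) <-> eval x e.1 = eval x e.2.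
  move=> eF; rewrite /satisfies !eval_subst.
  by rewrite !(@eq_eval _ _ _ (fun y => eval (x \o g) ((Var \o r) y)) x) //=;
     move=> y /set_mem ye; rewrite gr //; apply/mem_set; exists e => //;
     [right|left].
apply/sE; first by left.
apply: (QC _ (Implication (s @` F) (s c))); first exact: finite_image.
  move=> w wF; rewrite /satisfies !eval_subst; apply: Fc => e Fe.
  by have := wF (s e) (imageP s Fe); rewrite /satisfies !eval_subst.
by move=> _ [e Fe <-]; apply/sE; [right|exact: xF].
Qed.

Lemma Qvar_opLs_Res : class_incl (Qvar (class_of B)) (opLs (Res B)).
Proof.
move=> C QC; have [c0] := algebra_inhabited C.
have T0 : inhabited (term L C) by exists; exact: Var.
pose E := [set e : term L C * term L C | eval id e.1 = eval id e.2].
exists _, (radical_index B E), (radical_system B E T0), (radical_index_directed B E).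
split=> [i||]; [exact: radical_obj_Res|exact: radical_system_epimorphic|].
apply: isomorphic_trans (radical_system_limit B E T0); apply: isomorphic_sym.
apply: (@ker_isomorphic _ _ _ (closed_congruence T0 _) (eval id)) => //.
(* Finite consequences of [E] are true in [C] because [C] is in Qvar(B); so the congruence is the
   kernel of evaluation. *)
- move=> t s [F [finF FE] Fts].
  exact: (@Qvar_consequences C C id (t, s) F (inhabits c0)).
- by move=> c; exists (Var c).
- by move=> t s ts; exact: sub_fin_consequences.
Qed.

Lemma opLs_SP : class_eq (opLs (opS (opP (class_of B)))) (Qvar (class_of B)).
Proof.
move=> C; split=> [/opLs_opL/opLS-/(_ (Res B))CL|/Qvar_opLs_Res].
  by apply/opL_Res_Qvar/CL => A /ResE.
by apply: opLsS => A /ResE.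
Qed.

Lemma opL_SP : class_eq (opL (opS (opP (class_of B)))) (Qvar (class_of B)).
Proof.
move=> C; split=> [/opLS-/(_ (Res B))CL|/Qvar_opLs_Res/opLs_opL].
  by apply/opL_Res_Qvar/CL => A /ResE.
by apply: opLS => A /ResE.
Qed.

Lemma opLfg_SP : class_eq (opLfg (opS (opP (class_of B)))) (opLfg (Res B)).
Proof. by move=> C; split; apply: opLfgS => A /ResE. Qed.

(** The common form of conditions 5 to 7, linking them to compactness. *)
Definition fg_separated : Prop :=
  forall C, Qvar (class_of B) C -> finitely_generated C -> Res B C.

Lemma fg_separated_coordinate : fg_separated <->
  forall C, Qvar (class_of B) C -> finitely_generated C -> coordinate_algebra B C.
Proof.
split=> H C QC fgC; first by apply/coordinate_algebraP; split=> //; exact: H.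
by have [] := (coordinate_algebraP B C).1 (H C QC fgC).
Qed.

Lemma fg_separated_omega : fg_separated <->
  class_eq (op_omega (Qvar (class_of B))) (op_omega (Pvar (class_of B))).
Proof.
split=> [H C|H C QC fgC].
  split=> -[CK fgC]; split=> //; first by apply/PvarE; exact: H.
  exact/Res_Qvar/PvarE.
by apply/PvarE; have [] := (H C).1 (conj QC fgC).
Qed.

Lemma fg_separated_Lfg : fg_separated <->
  class_eq (Qvar (class_of B)) (opLfg (Res B)).
Proof.
split=> [H C|H C QC fgC].
  split=> [QC D|]; last exact: Lfg_Res_Qvar.
  apply: H; apply: Qvar_inj QC; [exact: val_hom|exact: val_inj].
have [c0] := algebra_inhabited C.
(* The condition is applied to [C] as a subalgebra of itself. *)
have Tcl : @op_closed _ C setT by [].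
pose D := Subalgebra Tcl (ex_intro _ c0 I).
have CD : isomorphic C (sub_algebra D).
  apply: (@inj_surj_isomorphic _ _ _ (fun c => exist _ c (mem_set I) : sub_algebra D)).
  - by move=> f a; exact: val_inj.
  - by move=> a b /(congr1 val).
  - by move=> b; exists (val b); exact: val_inj.
apply: (Res_iso CD); apply: (H C).1 => //.
exact: iso_finitely_generated CD fgC.
Qed.

(** Equivalent to [q_omega_compact], phrased with [consequences]. *)
Definition compact : Prop := forall n (S : set (equation L n)),
  consequences B S `<=` fin_consequences B S.

Lemma fg_separated_compact : fg_separated <-> compact.
Proof.
split=> [H n S c Sc|H C QC /finitely_generatedP[n [x gx]] c1 c2].
  have T0 : inhabited (term L 'I_n) by exists; exact: c.1.
  apply: (quot_Res_consequences (T0 := T0)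
    (Rcl := @fin_consequences_closed _ B _ S)) Sc.
    exact: sub_fin_consequences.
  apply: H; first exact: closed_quot_Qvar.
  by apply/finitely_generatedP; exists n; eexists; exact: closed_quot_generates.
have [t1 <-] := gx c1; have [t2 <-] := gx c2 => t12.
pose S := [set e : equation L n | satisfies x e].
(* Otherwise, by compactness, finitely many relations would imply [t1 = t2] over [B]; this
   quasi-identity would identify the two elements of [C]. *)
have [v vS v12] : exists2 v : 'I_n -> B, models v S & eval v t1 <> eval v t2.
  apply: contrapT => nv; have [v vS|F [finF FS] Ft] := H n S (t1, t2).
    by apply: contrapT => v12; apply: nv; exists v.
  by apply: t12; move/QvarP: QC => /(_ n (Implication F (t1, t2)) finF Ft); exact.
(* [v] satisfies every relation between the generators, so sending [x] to [v] is well defined on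
   [C]. *)
have [h hv] : exists h : C -> B, forall t, h (eval x t) = eval v t.
  exists (fun c => eval v (projT1 (cid (gx c)))) => t.
  by case: cid => s /= st; exact: (vS (s, t)).
exists h; last by rewrite !hv.
move=> f a; pose b k := projT1 (cid (gx (a k))).
have ab k : eval x (b k) = a k by rewrite /b; case: cid.
have -> : op C f a = eval x (App f b) by congr (op C f _); exact: funext.
by rewrite hv; congr (op B f _); apply: funext => k /=; rewrite -ab hv.
Qed.

End Classes.

(** * Satisfiability, directed unions of radical ideals and limits of coordinate algebras *)

Section Equations.
Variables (L : language) (B : algebra L).

Lemma radicalE n (S : set (equation L n)) : radical B S = consequences B S.
Proof.
apply/seteqP; split=> [e Se v vS|e Se v vS _ ->]; last exact: Se.
exact: Se.
Qed.

(** [S] together with the negation of [c] is unsatisfiable exactly when [c] is a consequence of [S]: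
    the condition is compactness in contrapositive form. *)
Lemma compact_finite_satisfiability : compact B <->
  forall (n : nat) (S : set (equation L n)) (c : equation L n),
    finitely_satisfiable B (@Pos L n @` S `|` [set Neg c]) ->
    satisfiable B (@Pos L n @` S `|` [set Neg c]).
Proof.
have satP n (S : set (equation L n)) c :
    satisfiable B (@Pos L n @` S `|` [set Neg c]) <-> ~ consequences B S c.
  split=> [[v vT] Sc|nSc].
    apply: (vT (Neg c)); first by right.
    by apply: Sc => e Se; apply: (vT (Pos e)); left; exists e.
  apply: contrapT => nsat; apply: nSc => v vS; apply: contrapT => vc.
  by apply: nsat; exists v => _ [[e Se <-]|->]; [exact: vS|].
split=> [H n S c fs|H n S c Sc].
  apply/satP => /H[F [finF FS]]; apply/satP/fs.
    by rewrite finite_setU; split; [exact: finite_image|exact: finite_set1].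
  by move=> _ [[e Fe <-]|->]; [left; exists e => //; exact: FS|right].
have [T [finT TS nsat]] : exists T, [/\ finite_set T,
    T `<=` @Pos L n @` S `|` [set Neg c] & ~ satisfiable B T].
  apply: contrapT => nT; apply/(satP n S c): Sc; apply: H => T finT TS.
  by apply: contrapT => nsat; apply: nT; exists T.
(* The positive part of [T] implies [c], since the only possible negative literal is [Neg c]. *)
exists [set e | T (Pos e)].
  split=> [|e /TS[[d Sd [<-]]//|//]].
  have Posinj : {in @Pos L n @^-1` T &, injective (@Pos L n)} by move=> ? ? _ _ [].
  exact: finite_preimage Posinj finT.
move=> v vT; apply: contrapT => vc; apply: nsat; exists v => l Tl.
by case/TS: (Tl) => [[e _ le]|->//]; rewrite -le in Tl *; exact: vT.
Qed.

(** A finite part of the union lies in one member by directedness, and that member already contains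
    its consequences. *)
Lemma compact_directed_union n d (I : porderType d) (S : I -> set (equation L n)) :
  compact B -> directed I -> (forall i, radical_ideal B (S i)) ->
  (forall i j : I, (i <= j)%O -> S i `<=` S j) ->
  radical_ideal B (\bigcup_i S i).
Proof.
move=> H dirI Srad Smono; rewrite /radical_ideal radicalE.
apply/seteqP; split=> [|e /H[F [finF FS] Fe]]; first exact: sub_consequences.
have [e' i j /Smono|e' /FS[i _ Sie]|i Fi] :=
  directed_finite (Q := fun e i => S i e) dirI finF; [exact|by exists i|].
by exists i => //; rewrite Srad radicalE; exact: consequencesS Fe.
Qed.

(** The radicals of the finite subsystems of [S] have union [fin_consequences B S]; being radical
    and containing [S], it contains all consequences of [S]. *)
Lemma directed_union_compact :
  (forall (n : nat) (d : Order.disp_t) (I : porderType d)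
       (S : I -> set (equation L n)),
     directed I -> (forall i, radical_ideal B (S i)) ->
     (forall i j : I, (i <= j)%O <-> S i `<=` S j) ->
     radical_ideal B (\bigcup_i S i)) ->
  compact B.
Proof.
move=> H n S.
have UE : \bigcup_(i : radical_index B S) val i = fin_consequences B S.
  apply/seteqP; split=> [e [i _ ie]|e /radical_index_cover[i ie]]; last by exists i.
  by apply/radical_index_cover; exists i.
rewrite -UE (H n _ (radical_index B S) val).
- by rewrite radicalE UE; apply: consequencesS; exact: sub_fin_consequences.
- exact: radical_index_directed.
- move=> i; have [F _ ->] := set_mem (valP i).
  rewrite /radical_ideal radicalE; apply/seteqP; split; first exact: sub_consequences.
  exact: consequences_sub.
- by move=> i j; exact: radical_index_le.
Qed.

(** The limit lies in Qvar(B), and the generators of any one stage generate it because the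
    transition maps match generators. *)
Lemma limit_coordinate_algebra n d (I : porderType d) (Lam : direct_system L I)
    (dirI : directed I) (x : forall i, 'I_n -> obj Lam i) :
  fg_separated B -> (forall i, coordinate_algebra B (obj Lam i)) ->
  (forall i, generated (range (x i)) = setT) ->
  (forall (i j : I) (ij : (i <= j)%O) k, tr Lam ij (x i k) = x j k) ->
  coordinate_algebra B (direct_limit Lam dirI).
Proof.
move=> H coord gen xE; apply/(fg_separated_coordinate B).1 => //.
  apply: opL_Res_Qvar; exists d, I, Lam, dirI; split; last exact: isomorphic_refl.
  by move=> i; have [] := (coordinate_algebraP B (obj Lam i)).1 (coord i).
have [i0] := dirI.1; apply/finitely_generatedP.
exists n, (@lim_inj _ _ _ Lam dirI i0 \o x i0) => y.
have [i [z <-]] := lim_inj_surj y; have [j [ij i0j]] := dirI.2 i i0.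
have : range (eval (x j)) (tr Lam ij z) by rewrite -generated_range gen.
move=> [t _ tz]; exists t; rewrite -(lim_inj_tr dirI ij) -tz.
rewrite (eval_hom (x j) t (@lim_inj_hom _ _ _ Lam dirI j)).
by congr eval; apply: funext => k /=; rewrite -(lim_inj_tr dirI i0j) xE.
Qed.

(** Up to isomorphism, the limit of the radical system is the term algebra modulo the finite
    consequences of [S]; separation by [B] makes these all the consequences. *)
Lemma limit_coordinate_compact :
  (forall (n : nat) (d : Order.disp_t) (I : porderType d)
       (Lam : direct_system L I) (dirI : directed I)
       (x : forall i, 'I_n -> obj Lam i),
     (forall i, coordinate_algebra B (obj Lam i)) ->
     (forall i, generated (range (x i)) = setT) ->
     epimorphic Lam ->
     (forall (i j : I) (ij : (i <= j)%O) (k : 'I_n),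
        tr Lam ij (x i k) = x j k) ->
     coordinate_algebra B (direct_limit Lam dirI)) ->
  compact B.
Proof.
move=> H n S c; have T0 : inhabited (term L 'I_n) by exists; exact: c.1.
pose Scl := @fin_consequences_closed _ B _ S.
apply: (quot_Res_consequences (T0 := T0) (Rcl := Scl)).
  exact: sub_fin_consequences.
apply: Res_iso (radical_system_limit B S T0) _.
pose x i k : obj (radical_system B S T0) i :=
  quot_class (radical_congruence T0 i) (Var k).
have genx i : generates (x i) by exact: closed_quot_generates.
apply: (proj2 ((coordinate_algebraP B _).1 _)); apply: (H n _ _ _ _ x).
- move=> i; apply/coordinate_algebraP; split; last exact: radical_obj_Res.
  by apply/finitely_generatedP; exists n, (x i).
- move=> i; rewrite generated_range -subTset => a _.
  by have [t ta] := genx i a; exists t.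
- exact: radical_system_epimorphic.
- by move=> i j ij k; exact: radical_tr_class.
Qed.

End Equations.

(** * The cycle of implications, through [compact] and [fg_separated] *)

Theorem theorem4p1 (L : language) (B : algebra L) :
  [<->
   q_omega_compact B;
   forall (n : nat) (S : set (equation L n)) (c : equation L n),
     radical B S c ->
     exists Sc : set (equation L n),
       [/\ finite_set Sc, Sc `<=` S & radical B Sc c];
   forall (n : nat) (S : set (equation L n)) (c : equation L n),
     holds B (Implication S c) ->
     exists Sc : set (equation L n),
       [/\ finite_set Sc, Sc `<=` S & holds B (Implication Sc c)];
   forall (n : nat) (S : set (equation L n)) (c : equation L n),
     finitely_satisfiable B (@Pos L n @` S `|` [set Neg c]) ->
     satisfiable B (@Pos L n @` S `|` [set Neg c]);
   forall C : algebra L, Qvar (class_of B) C -> finitely_generated C ->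
     coordinate_algebra B C;
   class_eq (op_omega (Qvar (class_of B))) (op_omega (Pvar (class_of B)));
   class_eq (Qvar (class_of B)) (opLfg (Res B));
   class_eq (opLs (opS (opP (class_of B)))) (opLfg (opS (opP (class_of B))));
   class_eq (opL (opS (opP (class_of B)))) (opLfg (opS (opP (class_of B))));
   forall (n : nat) (S : set (equation L n)),
     radical B S =
     \bigcup_(S0 in [set S0 | finite_set S0 /\ S0 `<=` S]) radical B S0;
   forall (n : nat) (d : Order.disp_t) (I : porderType d)
       (S : I -> set (equation L n)),
     directed I ->
     (forall i, radical_ideal B (S i)) ->
     (forall i j : I, (i <= j)%O <->
        (forall t s, theta (S i) t s -> theta (S j) t s)) ->
     radical_ideal B (\bigcup_i S i);
   forall (n : nat) (d : Order.disp_t) (I : porderType d)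
       (Lam : direct_system L I) (dirI : directed I)
       (x : forall i, 'I_n -> obj Lam i),
     (forall i, coordinate_algebra B (obj Lam i)) ->
     (forall i, generated (range (x i)) = setT) ->
     epimorphic Lam ->
     (forall (i j : I) (ij : (i <= j)%O) (k : 'I_n),
        tr Lam ij (x i k) = x j k) ->
     coordinate_algebra B (direct_limit Lam dirI)].

Proof.
have compactE : q_omega_compact B <-> compact B.
  split=> H n S c Sc.
    have [|F [finF FS Fc]] := H n S c; first by rewrite -radicalE in Sc.
    by exists F; rewrite // -radicalE.
  have [F [finF FS] Fc] : fin_consequences B S c by apply: H; rewrite -radicalE.
  by exists F; split=> //; rewrite -radicalE in Fc.
have sepE := fg_separated_compact B.
tfae.
- by [].
- move=> H n S c Sc; have [|F [finF FS Fc]] := H n S c.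
    by rewrite radicalE; exact: Sc.
  by exists F; split=> //; rewrite radicalE in Fc; exact: Fc.
- move=> H; apply/compact_finite_satisfiability => n S c Sc.
  by have [F [finF FS Fc]] := H n S c Sc; exists F.
- by move/compact_finite_satisfiability/sepE/fg_separated_coordinate.
- by move/fg_separated_coordinate/fg_separated_omega.
- by move/fg_separated_omega/fg_separated_Lfg.
(* Conditions 7 to 9 differ only by Qvar(B) = Ls SP(B) = L SP(B) and Res(B) = SP(B). *)
- move=> H C; split=> [/opLs_SP/H/opLfg_SP//|/opLfg_SP/H/opLs_SP//].
- move=> H C; split=> [/opL_SP/opLs_SP/H//|/H/opLs_SP/opL_SP//].
(* Condition 9 is read back as 7, which gives compactness, the nontrivial inclusion of 10. *)
- move=> H n S; have /sepE HS : fg_separated B.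
    apply/fg_separated_Lfg => C.
    by split=> [/opL_SP/H/opLfg_SP//|/opLfg_SP/H/opL_SP//].
  under eq_bigcupr do rewrite radicalE.
  rewrite radicalE; apply/seteqP; split=> [|e [F [_ FS]]]; first exact: HS.
  exact: consequencesS.
- move=> H n d I S dirI Srad Sle; apply: compact_directed_union => //.
    move=> m T; have := H m T; rewrite radicalE => ->.
    by move=> e [F FT]; rewrite radicalE; exists F.
  by move=> i j /Sle ij [t s]; exact: ij.
- move=> H n d I Lam dirI x coord gen _ xE.
  (* Condition 11 enters only through compactness. *)
  apply: limit_coordinate_algebra gen xE => //; apply/sepE.
  apply: directed_union_compact => m d' J S dirJ Srad Sle; apply: H => // i j.
  split=> [/Sle ij t s|ij]; first exact: ij.
  by apply/Sle => -[t s]; exact: ij.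
- by move/limit_coordinate_compact/compactE.
Qed.
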